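(* Let $K$ be a number field, let $G$ be a finite group, and let $\bar X\to\mathbb{P}^1_{\bar{\mathbb{Q}}}$ be a $G$-Galois branched cover over $\bar{\mathbb{Q}}$. Let $F$ be the field of moduli of $\bar X\to\mathbb{P}^1_{\bar{\mathbb{Q}}}$ as a mere cover, and let $M$ be the field of moduli of $\bar X\to\mathbb{P}^1_{\bar{\mathbb{Q}}}$ as a $G$-Galois branched cover. Then $M$ is Galois over $F$ with Galois group a subquotient of $\mathrm{Aut}(G)$.
   Context: For an integral scheme $Z$, $\kappa(Z)$ denotes its function field. A branched cover (or mere cover) $X\to Y$, with $X$ a normal integral scheme and $Y$ a regular integral scheme, is a finite, generically étale map; its branch divisor $B\subset Y$ is the codimension $1$ reduced induced subscheme made up of the branch locus. It is Galois if $\mathrm{Aut}(X/Y)$ acts freely and transitively on the geometric fibers over $Y\smallsetminus B$. A $G$-Galois branched cover is a pair $(X\to Y,\Phi)$ (the $\Phi$ is often suppressed), where $X\to Y$ is a Galois branched cover and $\Phi:\mathrm{Gal}(\kappa(X)/\kappa(Y))\to G$ is an isomorphism. Two mere covers of $Y$ are isomorphic as mere covers if they are isomorphic over $Y$; two $G$-Galois branched covers of $Y$ are isomorphic as $G$-Galois branched covers if there is such an isomorphism that is compatible with the given isomorphisms of the Galois groups with $G$. Here $K^{\mathrm{sep}}=\bar{\mathbb{Q}}$ and the base is $\mathbb{P}^1_{\bar{\mathbb{Q}}}$ with its $K$-model $\mathbb{P}^1_K$. For $\sigma\in\mathrm{Gal}(\bar{\mathbb{Q}}/K)$, let $\bar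 X^\sigma\to\mathbb{P}^1_{\bar{\mathbb{Q}}}=\mathbb{P}^1_K\times_K\bar{\mathbb{Q}}$ denote the twist of $\bar X\to\mathbb{P}^1_{\bar{\mathbb{Q}}}$ by $\sigma$ (with the transported isomorphism of its Galois group with $G$). The field of moduli of $\bar X\to\mathbb{P}^1_{\bar{\mathbb{Q}}}$ as a $G$-Galois branched cover (resp. as a mere cover) is the subfield of $\bar{\mathbb{Q}}$ fixed by the subgroup of $\mathrm{Gal}(\bar{\mathbb{Q}}/K)$ consisting of those $\sigma$ for which $\bar X^\sigma\to\mathbb{P}^1_{\bar{\mathbb{Q}}}$ is isomorphic to $\bar X\to\mathbb{P}^1_{\bar{\mathbb{Q}}}$ as a $G$-Galois branched cover (resp. as a mere cover). *)

(* Defs.v *)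
From HB Require Import structures.
From mathcomp Require Import all_boot all_order all_algebra all_fingroup all_field.
From mathcomp Require Import fraction generic_quotient.
From mathcomp Require Import boolp classical_sets functions.
Set Implicit Arguments.
Unset Strict Implicit.
Unset Printing Implicit Defensive.

Import GRing.Theory.
Local Open Scope classical_set_scope.
Local Open Scope ring_scope.

(* Galois groups are sets of functions; the group law is composition. *)
Definition ring_aut (L : fieldType) (g : L -> L) : Prop :=
  [/\ zmod_morphism g, monoid_morphism g & bijective g].

Definition Gal (L : fieldType) (E : set L) : set (L -> L) :=
  [set g | ring_aut g /\ forall x, E x -> g x = x].

Definition Gal_isom (L : fieldType) (E : set L) (gT : finGroupType)
    (A : {set gT}) (f : (L -> L) -> gT) : Prop :=
  set_bij (Gal E) [set` A] f /\
  forall g h, Gal E g -> Gal E h -> f (g \o h) = (f g * f h)%g.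

(* The fraction field of {poly algC} is the function field Qbar(t) of the
   projective line P^1 over Qbar.  P^1 is the union of two affine lines, with
   coordinates t (index false) and 1/t (index true); [P1coord b] is the
   coordinate of chart b, and [P1fun b p] is the regular function on chart b
   which is the polynomial p in this coordinate. *)
Notation Qbart := {fraction {poly algC}}.

Definition P1coord (b : bool) : Qbart :=
  if b then (FracField.tofrac ('X : {poly algC}))^-1
  else FracField.tofrac ('X : {poly algC}).

Definition P1fun (b : bool) (p : {poly algC}) : Qbart :=
  (map_poly (fun c : algC => FracField.tofrac c%:P) p).[P1coord b].

(* The action on Qbar(t) of an automorphism s of Qbar, through the
   coefficients: t is fixed since P^1 has its standard model over K. *)
Section FracMap.
Variable s : {rmorphism algC -> algC}.

Definition frac_map (f : Qbart) : Qbart :=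
  FracField.tofrac (map_poly s (frac (repr f)).1) /
  FracField.tofrac (map_poly s (frac (repr f)).2).

Lemma frac_numden (f : Qbart) :
  f = FracField.tofrac (frac (repr f)).1 / FracField.tofrac (frac (repr f)).2.
Proof.
have d0 : FracField.tofrac (frac (repr f)).2 != 0.
  by rewrite tofrac_eq0 denom_ratioP.
apply: (mulIf d0); rewrite divfK //.
rewrite -[X in X * _ = _]reprK; unlock FracField.tofrac.
rewrite !piE; apply/eqP; rewrite piE /= !FracField.equivfE /= /FracField.mulf.
by rewrite !numden_Ratio ?oner_neq0 ?mulf_neq0 ?denom_ratioP ?oner_neq0 // !mulr1 mulrC.
Qed.

Lemma frac_mapE (p q : {poly algC}) : q != 0 ->
  frac_map (FracField.tofrac p / FracField.tofrac q) =
  FracField.tofrac (map_poly s p) / FracField.tofrac (map_poly s q).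
Proof.
move=> q0; set f := _ / _.
have := frac_numden f; rewrite /frac_map /f.
set n := (frac _).1; set d := (frac _).2.
have d0 : d != 0 by exact: denom_ratioP.
move/eqP; rewrite eqr_div ?tofrac_eq0 // -!tofracM tofrac_eq => /eqP e.
apply/eqP; rewrite eqr_div ?tofrac_eq0 ?map_poly_eq0 // -!tofracM tofrac_eq.
by rewrite -!rmorphM /= e.
Qed.

Fact frac_map_zmod_morphism : zmod_morphism frac_map.
Proof.
move=> f g; rewrite (frac_numden f) (frac_numden g).
have := denom_ratioP (repr f); have := denom_ratioP (repr g).
move: (frac (repr f)) (frac (repr g)) => [n d] [n' d'] /= d'0 d0.
rewrite -mulNr addf_div ?tofrac_eq0 // -tofracN -!tofracM -tofracD.
rewrite !frac_mapE ?mulf_neq0 // -mulNr addf_div ?tofrac_eq0 ?map_poly_eq0 //.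
by rewrite rmorphD !rmorphM rmorphN /= -tofracN -!tofracM -tofracD.
Qed.

Fact frac_map_monoid_morphism : monoid_morphism frac_map.
Proof.
split; first by rewrite -[X in frac_map X](divr1 1) -tofrac1 frac_mapE ?oner_neq0 //
  rmorph1 tofrac1 divr1.
move=> f g; rewrite (frac_numden f) (frac_numden g).
have := denom_ratioP (repr f); have := denom_ratioP (repr g).
move: (frac (repr f)) (frac (repr g)) => [n d] [n' d'] /= d'0 d0.
rewrite mulf_div -!tofracM !frac_mapE ?mulf_neq0 //.
by rewrite mulf_div -!tofracM !rmorphM.
Qed.

HB.instance Definition _ :=
  GRing.isZmodMorphism.Build Qbart Qbart frac_map frac_map_zmod_morphism.
HB.instance Definition _ :=
  GRing.isMonoidMorphism.Build Qbart Qbart frac_map frac_map_monoid_morphism.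

End FracMap.

(* A finite (hence affine) dominant morphism f : X -> P^1 with X integral is
   the relative spectrum of the coherent algebra f_* O_X.  It is given here by
   the function field of X, the field embedding Qbar(t) -> kappa(X) defined by
   f, and the subrings [sect b] = O_X(f^-1(chart b)) of kappa(X). *)
Record P1scheme := MkP1scheme {
  ffield : fieldType;
  pullback : {rmorphism Qbart -> ffield};
  sect : bool -> {pred ffield}
}.
Arguments sect : clear implicits.

Definition chart_fun (X : P1scheme) (b : bool) (p : {poly algC}) : ffield X :=
  pullback X (P1fun b p).

Definition finite_chart (X : P1scheme) (b : bool) : Prop :=
  [/\ subring_closed (sect X b),
      forall p, chart_fun X b p \in sect X b
    & exists2 s : seq (ffield X), {subset s <= sect X b} &
        forall x, x \in sect X b -> exists c : nat -> {poly algC},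
          x = \sum_(i < size s) chart_fun X b (c i) * s`_i].

Definition normal_chart (X : P1scheme) (b : bool) : Prop :=
  (forall x, exists u v, [/\ u \in sect X b, v \in sect X b, v != 0 & x = u / v])
  /\ (forall (x : ffield X) (p : {poly ffield X}),
        p \is monic -> p \is a polyOver (sect X b) -> root p x -> x \in sect X b).

(* Both sides are the ring of functions on the preimage of the intersection
   of the charts: O_X(chart 0)[1/t] = O_X(chart 1)[t]. *)
Definition glued (X : P1scheme) : Prop :=
  forall x : ffield X,
    (exists n, x * pullback X (P1coord false) ^+ n \in sect X false) <->
    (exists n, x * pullback X (P1coord true) ^+ n \in sect X true).

Definition generically_etale (X : P1scheme) : Prop :=
  forall x : ffield X, exists2 p : {poly Qbart},
    separable_poly p & root (map_poly (pullback X) p) x.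

Definition branched_cover (X : P1scheme) : Prop :=
  [/\ forall b, finite_chart X b, forall b, normal_chart X b, glued X
    & generically_etale X].

Definition prime_ideal (L : fieldType) (A P : {pred L}) : Prop :=
  [/\ {subset P <= A}, 0 \in P /\ 1 \notin P,
      forall x y, x \in P -> y \in P -> x + y \in P,
      forall a x, a \in A -> x \in P -> a * x \in P
    & forall x y, x \in A -> y \in A -> x * y \in P -> (x \in P) || (y \in P)].

(* Etaleness of X -> P^1 at the point P of the spectrum of A = sect b.  As A
   is torsion-free over a principal ideal domain it is flat, and residue
   fields have characteristic 0, so etale means that the maximal ideal m_P of
   the local ring A_P is generated by that of the image point: every z in P
   has, in A_P, the form q * (w / u) with q in the prime ideal of
   the image of P. *)
Definition etale_at (X : P1scheme) (b : bool) (P : {pred ffield X}) : Prop :=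
  forall z, z \in P -> exists u w (q : {poly algC}),
    [/\ u \in sect X b, u \notin P, w \in sect X b, chart_fun X b q \in P
      & u * z = chart_fun X b q * w].

(* The closed points of the branch divisor in chart b, by their coordinate;
   the cover being generically etale, all points of the branch locus are
   closed. *)
Definition branch_locus (X : P1scheme) (b : bool) : set algC :=
  [set a | exists P : {pred ffield X},
     [/\ prime_ideal (sect X b) P, chart_fun X b ('X - a%:P) \in P
       & ~ etale_at b P]].

(* phi is the map on function fields of an isomorphism X2 -> X1 over P^1. *)
Definition cover_isom (X1 X2 : P1scheme) (phi : ffield X1 -> ffield X2) : Prop :=
  [/\ zmod_morphism phi, monoid_morphism phi & bijective phi] /\
  [/\ forall f, phi (pullback X1 f) = pullback X2 f
    & forall b x, (phi x \in sect X2 b) = (x \in sect X1 b)].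

Definition Aut_cover (X : P1scheme) : set (ffield X -> ffield X) :=
  [set g | cover_isom g].

(* The geometric fiber of X over the geometric point y : Spec Omega -> P^1
   of chart b, that is, the set of morphisms of Qbar[t_b]-algebras from sect b
   to Omega.  Only the values on sect b of the function x are meaningful. *)
Definition geometric_fiber (X : P1scheme) (b : bool) (Omega : closedFieldType)
    (y : {rmorphism {poly algC} -> Omega}) : set (ffield X -> Omega) :=
  [set x : ffield X -> Omega | [/\ {in sect X b &, {morph x : u v / u + v}},
               {in sect X b &, {morph x : u v / u * v}}
             & forall p, x (chart_fun X b p) = y p]].

Definition unbranched_point (X : P1scheme) (b : bool) (Omega : closedFieldType)
    (y : {rmorphism {poly algC} -> Omega}) : Prop :=
  forall a, branch_locus X b a -> y ('X - a%:P) != 0.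

Definition galois_cover (X : P1scheme) : Prop :=
  branched_cover X /\
  forall (b : bool) (Omega : closedFieldType)
      (y : {rmorphism {poly algC} -> Omega}), unbranched_point X b y ->
    (forall g x, Aut_cover g -> geometric_fiber b y x ->
       {in sect X b, x \o g =1 x} -> g = id) /\
    (forall x x', geometric_fiber b y x -> geometric_fiber b y x' ->
       exists2 g, Aut_cover g & {in sect X b, x \o g =1 x'}).

Definition Gal_cover (X : P1scheme) : set (ffield X -> ffield X) :=
  Gal (range (pullback X)).

Definition G_galois_cover (G : finGroupType) (X : P1scheme)
    (Phi : (ffield X -> ffield X) -> G) : Prop :=
  galois_cover X /\ Gal_isom (range (pullback X)) [set: G]%SET Phi.

Definition mere_isomorphic (X1 X2 : P1scheme) : Prop :=
  exists phi : ffield X1 -> ffield X2, cover_isom phi.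

Definition G_isomorphic (G : finGroupType)
    (X1 : P1scheme) (Phi1 : (ffield X1 -> ffield X1) -> G)
    (X2 : P1scheme) (Phi2 : (ffield X2 -> ffield X2) -> G) : Prop :=
  exists2 phi : ffield X1 -> ffield X2, cover_isom phi &
    forall g1 g2, Gal_cover g1 -> Gal_cover g2 ->
      phi \o g1 =1 g2 \o phi -> Phi1 g1 = Phi2 g2.

(* The base change of X by s: the projection X^s -> X is an isomorphism of
   schemes lying over the isomorphism of P^1 induced by s.  Identifying X^s
   with X by it, only the structure morphism changes, and
   Gal (kappa(X^s) / Qbar(t)), as a group of automorphisms of
   kappa(X^s) = kappa(X), is Gal (kappa(X) / Qbar(t)): the transported
   isomorphism with G is the same function. *)
Definition twist (s : {rmorphism algC -> algC}) (X : P1scheme) : P1scheme :=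
  @MkP1scheme (ffield X)
    (pullback X \o frac_map (algC_invaut s) : {rmorphism Qbart -> ffield X})
    (sect X).

Definition twist_Gal (G : finGroupType) (s : {rmorphism algC -> algC})
    (X : P1scheme) (Phi : (ffield X -> ffield X) -> G) :
    (ffield (twist s X) -> ffield (twist s X)) -> G := Phi.

(* Ring endomorphisms of algC are bijective: see algC_autK, algC_invautK. *)
Definition absolute_Gal (K : fieldExtType rat) (iota : {rmorphism K -> algC}) :
    set {rmorphism algC -> algC} :=
  [set s | forall a, s (iota a) = iota a].

Section FixedField.
Variable S : set {rmorphism algC -> algC}.

Definition fixed_pred : {pred algC} := fun x => `[< forall s, S s -> s x = x >].

Fact fixed_pred_divring : divring_closed fixed_pred.
Proof.
have fixP x : (x \in fixed_pred) <-> (forall s, S s -> s x = x).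
  by rewrite unfold_in; split=> [/asboolP|] // ?; apply/asboolP.
split; first by apply/fixP => s _; exact: rmorph1.
  by move=> x y /fixP hx /fixP hy; apply/fixP => s Ss; rewrite rmorphB hx ?hy.
by move=> x y /fixP hx /fixP hy; apply/fixP => s Ss; rewrite fmorph_div /= hx ?hy.
Qed.

HB.instance Definition _ :=
  GRing.isDivringClosed.Build algC fixed_pred fixed_pred_divring.

Definition fixed_field : divringClosed algC := fixed_pred.

End FixedField.

Definition mere_field_of_moduli (K : fieldExtType rat)
    (iota : {rmorphism K -> algC}) (X : P1scheme) : divringClosed algC :=
  fixed_field [set s | absolute_Gal iota s /\ mere_isomorphic (twist s X) X].

Definition G_field_of_moduli (K : fieldExtType rat)
    (iota : {rmorphism K -> algC}) (G : finGroupType)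
    (X : P1scheme) (Phi : (ffield X -> ffield X) -> G) : divringClosed algC :=
  fixed_field [set s | absolute_Gal iota s /\
                       G_isomorphic (twist_Gal (s := s) Phi) Phi].

Section Subfield.
Variable E : divringClosed algC.

Record subfield_of := Subfield { subfield_val : algC; _ : subfield_val \in E }.

HB.instance Definition _ := [isSub for subfield_val].
HB.instance Definition _ := [Choice of subfield_of by <:].
HB.instance Definition _ := [SubChoice_isSubComUnitRing of subfield_of by <:].
HB.instance Definition _ := [SubComUnitRing_isSubIntegralDomain of subfield_of by <:].
HB.instance Definition _ := [SubIntegralDomain_isSubField of subfield_of by <:].

End Subfield.

Definition minimal_polynomial (F : divringClosed algC) (x : algC)
    (p : {poly algC}) : Prop :=
  [/\ p \is monic, p \is a polyOver F, root p x
    & forall q, q \is a polyOver F -> q != 0 -> root q x -> (size p <= size q)%N].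

(* Algebraic, separable and normal. *)
Definition galois_extension (F M : divringClosed algC) : Prop :=
  {subset F <= M} /\
  forall x, x \in M -> exists p, [/\ minimal_polynomial F x p, separable_poly p
    & exists2 rs : seq algC, {subset rs <= M} & p = \prod_(r <- rs) ('X - r%:P)].

Definition Gal_ext (F M : divringClosed algC) : set (subfield_of M) :=
  [set x | subfield_val x \in F].

Definition Gal_subquotient_of_Aut (F M : divringClosed algC)
    (G : finGroupType) : Prop :=
  exists A B : {group {perm G}},
    [/\ A \subset Aut [set: G]%SET, (B <| A)%g
      & exists f : (subfield_of M -> subfield_of M) -> coset_of B,
          Gal_isom (@Gal_ext F M) (A / B)%g f].

(* Main.v *)
Require Import Defs.
From HB Require Import structures.
From mathcomp Require Import all_boot all_order all_algebra all_fingroup all_field.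
From mathcomp Require Import boolp classical_sets functions.
Import GRing.Theory Num.Theory.
Local Open Scope ring_scope.

(** Let H be the group of the s in Gal(Qbar/K) such that the twist of X by s
    is isomorphic to X as a mere cover.  An isomorphism X^s -> X is, on function
    fields, an automorphism phi of kappa(X) which restricts to s on Qbar(t).
    Conjugation by phi preserves Gal(kappa(X)/Qbar(t)), hence gives through Phi
    an automorphism a of G.  Write R a s when s admits such a phi inducing a.
    Then R is a subgroup of Aut(G) x H which projects onto H, and R 1 s says
    exactly that X^s and X are isomorphic as G-Galois covers.  So F is the
    fixed field of all the s occurring in R, and M that of the s with R 1 s.

    The rest is field theory on the relation R.  If R a s and R a t, then
    R 1 (t^-1 s), so s and t agree on M: the restriction of s to M depends only
    on a, and ranges over a finite set.  As R 1 s is a normal condition, M is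
    stable under every such s.  Hence a finite group acts on M with fixed field
    F, and Artin's theorem applies: the minimal polynomial over F of x in M is
    the product over its finite orbit ([fixed_field_galois]).  An automorphism
    of M over F sends each x to a root of that polynomial, so it agrees at each
    point with one of finitely many s; it then agrees everywhere with one of
    them ([pointwise_among_finite]).  Therefore a |-> s|_M is a surjection onto
    Gal(M/F) from the group A of all a occurring in R, a subgroup of Aut(G), and
    Gal(M/F) is A modulo the kernel of this map ([gal_label_isom]).

    The relation R need not be a function: a is determined by s only up to
    inner automorphisms of G.  Working with all the pairs (a, s), instead of a
    map from H to Out(G), gives the subquotient of Aut(G) directly. *)

(** * Ring morphisms agreeing pointwise with a finite family *)

(** Bundles a function already known to be a ring morphism, so that the theory of
    ring morphisms applies to the bare functions that make up Galois groups. *)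
Lemma rmorphism_of (R S : nzRingType) (g : R -> S) :
  zmod_morphism g -> monoid_morphism g ->
  exists h : {rmorphism R -> S}, g = h :> (R -> S).
Proof.
move=> gD gM.
pose zmodM := GRing.isZmodMorphism.Build R S g gD.
pose monM := GRing.isMonoidMorphism.Build R S g gM.
pose h : {rmorphism R -> S} := HB.pack g zmodM monM.
by exists h.
Qed.

Lemma nonroot_nat (C : numDomainType) (p : {poly C}) :
  p != 0 -> exists n : nat, p.[n%:R] != 0.
Proof.
move=> p0; apply: contrapT => none.
have all0 : all (root p) [seq n%:R | n <- iota 0 (size p)].
  apply/allP => _ /mapP[n _ ->]; apply: contrapT => /negP nr.
  by apply: none; exists n.
have := max_poly_roots p0 all0.
rewrite size_map size_iota ltnn map_inj_uniq ?iota_uniq => [/(_ isT)//|].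
by move=> m n /eqP; rewrite eqr_nat => /eqP.
Qed.

(** Choose for each i a point where f and fs i differ, and make these points the
    coefficients of a polynomial P.  The images of P under f and fs i are
    distinct polynomials; as the integers are infinitely many, at some integer n
    the images take distinct values for all i at once, which contradicts the
    hypothesis at P.[n]. *)
Lemma pointwise_among_finite (L : nzRingType) (C : numDomainType)
    (I : finType) (A : {set I}) (f : {rmorphism L -> C}) (fs : I -> {rmorphism L -> C}) :
  (forall u, exists2 i, i \in A & f u = fs i u) -> exists2 i, i \in A & f =1 fs i.
Proof.
move=> pw; apply: contrapT => none.
have diff i : exists u, i \in A -> f u != fs i u.
  apply: contrapT => nd; apply: none; exists i.
    by apply: contrapT => nA; apply: nd; exists 0.
  by move=> u; apply: contrapT => /eqP ne; apply: nd; exists u.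
pose y i := projT1 (cid (diff i)).
pose P := Poly [seq y i | i <- enum I].
pose D i := map_poly f P - map_poly (fs i) P.
have D0 : \prod_(i in A) D i != 0.
  apply/prodf_neq0 => i Ai; apply/eqP => /(congr1 (fun p : {poly C} => p`_(enum_rank i))).
  rewrite coef0 coefB !coef_map coef_Poly (nth_map i) -?cardE ?ltn_ord //.
  rewrite nth_enum_rank => /eqP; rewrite subr_eq0; apply/negP.
  exact: projT2 (cid (diff i)) Ai.
have [n] := nonroot_nat _ _ D0; rewrite horner_prod => /prodf_neq0 Dn.
have [i Ai] := pw P.[n%:R].
apply/eqP; rewrite -subr_eq0; have := Dn i Ai.
rewrite hornerD hornerN -[X in _.[X] - _](rmorph_nat f).
rewrite -[X in _ - _.[X]](rmorph_nat (fs i)).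
by rewrite !horner_map.
Qed.

(** * Artin's theorem for a group of labelled automorphisms *)

Lemma mem_fixed_field (S : set {rmorphism algC -> algC}) (x : algC) :
  (x \in fixed_field S) <-> (forall s, S s -> s x = x).
Proof. by rewrite unfold_in; split=> [/asboolP|] // ?; apply/asboolP. Qed.

Lemma fixed_subfieldS (S N : set {rmorphism algC -> algC}) :
  (forall s, N s -> S s) -> {subset fixed_field S <= fixed_field N}.
Proof.
by move=> sNS x /mem_fixed_field Fx; apply/mem_fixed_field => s /sNS; exact: Fx.
Qed.

Section ArtinRelation.

Variables (gT : finGroupType) (R : gT -> {rmorphism algC -> algC} -> Prop).
Hypothesis R1 : R 1%g idfun.
Hypothesis RM : forall a b (s t : {rmorphism algC -> algC}),
  R a s -> R b t -> R (a * b)%g (s \o t).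
Hypothesis RV : forall a s, R a s -> R a^-1%g (algC_invaut s).

Let F := fixed_field [set s | exists a, R a s].
Let M := fixed_field [set s | R 1%g s].

(** R 1 (t^-1 s), and M is fixed by all automorphisms labelled 1. *)
Lemma same_label_agree a s t x : R a s -> R a t -> x \in M -> s x = t x.
Proof.
move=> Ras Rat /mem_fixed_field Mx.
have Rts : R 1%g (algC_invaut t \o s).
  by have := RM _ _ _ _ (RV _ _ Rat) Ras; rewrite mulVg.
by rewrite -[in RHS](Mx _ Rts) /= algC_invautK.
Qed.

(** If n is labelled 1 then so is s^-1 n s: the stabilizer of M is normalized by s. *)
Lemma label_stable a s x : R a s -> x \in M -> s x \in M.
Proof.
move=> Ras /mem_fixed_field Mx; apply/mem_fixed_field => n Rn.
have Rsns : R 1%g (algC_invaut s \o (n \o s)).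
  by have := RM _ _ _ _ (RV _ _ Ras) (RM _ _ _ _ Rn Ras); rewrite mul1g mulVg.
by rewrite -[in RHS](Mx _ Rsns) /= algC_invautK.
Qed.

Definition labels : {set gT} := [set a | `[< exists s, R a s >]].

Lemma labelsP a : reflect (exists s, R a s) (a \in labels).
Proof. by rewrite inE; apply: asboolP. Qed.

(** Any automorphism labelled a would do, since only its values on M matter. *)
Definition labelled (a : gT) : {rmorphism algC -> algC} :=
  match pselect (exists s, R a s) with
  | left h => projT1 (cid h) | right _ => idfun end.

Lemma labelledP a : a \in labels -> R a (labelled a).
Proof.
move=> /labelsP Aa; rewrite /labelled; case: pselect => // h.
exact: projT2 (cid h).
Qed.

Definition orbit_seq (x : algC) : seq algC :=
  undup [seq labelled a x | a <- enum labels].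

Definition orbit_poly (x : algC) : {poly algC} :=
  \prod_(r <- orbit_seq x) ('X - r%:P).

Lemma mem_orbit_seq a s x : R a s -> x \in M -> s x \in orbit_seq x.
Proof.
move=> Ras Mx; rewrite mem_undup.
have Aa : a \in labels by apply/labelsP; exists s.
rewrite (same_label_agree _ _ _ _ Ras (labelledP _ Aa) Mx).
by apply: map_f; rewrite mem_enum.
Qed.

Lemma orbit_seqP x r : r \in orbit_seq x -> exists a s, R a s /\ r = s x.
Proof.
rewrite mem_undup => /mapP[a]; rewrite mem_enum => Aa ->.
by exists a, (labelled a); split=> //; exact: labelledP.
Qed.

Lemma orbit_poly_root a s x : R a s -> x \in M -> root (orbit_poly x) (s x).
Proof. by move=> Ras Mx; rewrite root_prod_XsubC; exact: mem_orbit_seq Ras Mx. Qed.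

(** Each s permutes the orbit of x, hence the factors of its polynomial. *)
Lemma orbit_poly_over x : x \in M -> orbit_poly x \is a polyOver F.
Proof.
move=> Mx; apply/polyOverP => i; apply/mem_fixed_field => s [a Ras].
have -> : s (orbit_poly x)`_i = (map_poly s (orbit_poly x))`_i by rewrite coef_map.
congr (_`_i); rewrite -(prod_map_poly _ _ xpredT).
(* An injection of a finite set into itself is a permutation. *)
have u : uniq (map s (orbit_seq x)).
  by rewrite map_inj_uniq ?undup_uniq //; exact: fmorph_inj.
have sub : {subset map s (orbit_seq x) <= orbit_seq x}.
  move=> _ /mapP[r /orbit_seqP[b [t [Rbt ->]]] ->].
  exact: (mem_orbit_seq _ _ _ (RM _ _ _ _ Ras Rbt)).
rewrite (perm_big (orbit_seq x)) //; apply: uniq_perm => //; first exact: undup_uniq.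
by have [] := uniq_min_size u sub; rewrite ?size_map.
Qed.

Lemma root_transport {q a s x} :
  q \is a polyOver F -> R a s -> root q x -> root q (s x).
Proof.
move=> /polyOverP qF Ras q0.
have <- : map_poly s q = q.
  by apply/polyP => i; rewrite coef_map; move/mem_fixed_field: (qF i); apply; exists a.
by rewrite rmorph_root.
Qed.

(** A polynomial over F vanishing at x vanishes on the orbit of x, so the orbit
    polynomial is minimal. *)
Lemma fixed_field_galois : galois_extension F M.
Proof.
split=> [|x Mx]; first by apply: fixed_subfieldS => s Rs; exists 1%g.
exists (orbit_poly x); split.
- split; [exact: monic_prod_XsubC|exact: orbit_poly_over| |].
    exact: (orbit_poly_root _ _ _ R1).
  move=> q qF q0 qx; rewrite size_prod_XsubC; apply: max_poly_roots => //.
    by apply/allP => r /orbit_seqP[a [s [Ras ->]]]; exact: root_transport Ras qx.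
  exact: undup_uniq.
- by rewrite separable_prod_XsubC undup_uniq.
- exists (orbit_seq x) => // r /orbit_seqP[a [s [Ras ->]]].
  exact: label_stable Ras Mx.
Qed.

Definition restricts (a : gT) (g : subfield_of M -> subfield_of M) : Prop :=
  exists2 s, R a s & forall u, subfield_val (g u) = s (subfield_val u).

Lemma restricts_id : restricts 1%g id.
Proof. by exists idfun. Qed.

Lemma restrictsM {a b g h} :
  restricts a g -> restricts b h -> restricts (a * b)%g (g \o h).
Proof.
move=> [s Ras gs] [t Rbt ht]; exists (s \o t); first exact: RM.
by move=> u /=; rewrite gs ht.
Qed.

Lemma restricts_inj {a g h} : restricts a g -> restricts a h -> g = h.
Proof.
move=> [s Ras gs] [t Rat ht]; apply/funext => u; apply: val_inj => /=.
by rewrite gs ht; apply: same_label_agree Ras Rat _; exact: valP.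
Qed.

Lemma restricts_exists {a} : a \in labels -> exists g, restricts a g.
Proof.
move=> /labelledP Ra.
exists (fun u => Subfield (label_stable _ _ _ Ra (valP u))).
by exists (labelled a).
Qed.

Lemma restricts_label {a g} : restricts a g -> a \in labels.
Proof. by move=> [s Ras _]; apply/labelsP; exists s. Qed.

Lemma labels_group_set : group_set labels.
Proof.
apply/group_setP; split=> [|a b /labelledP Ra /labelledP Rb].
  by apply/labelsP; exists idfun.
by apply/labelsP; eexists; exact: RM Ra Rb.
Qed.
Canonical labels_group := Group labels_group_set.

Lemma restricts_gal {a g} : restricts a g -> Defs.Gal (@Gal_ext F M) g.
Proof.
move=> ag; have [s Ras gs] := ag; split; last first.
  move=> u Fu; apply: val_inj => /=; rewrite gs.
  by move/mem_fixed_field: Fu; apply; exists a.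
split.
- by move=> u v; apply: val_inj => /=; rewrite !(gs, rmorphB).
- split; first by apply: val_inj; rewrite /= gs rmorph1.
  by move=> u v; apply: val_inj => /=; rewrite !(gs, rmorphM).
- have /restricts_exists[h ah] : a^-1%g \in labels by rewrite groupV (restricts_label ag).
  have := restrictsM ag ah; have := restrictsM ah ag; rewrite mulVg mulgV.
  move=> /restricts_inj/(_ restricts_id) gh /restricts_inj/(_ restricts_id) hg.
  by exists h => u; [move/(congr1 (@^~ u)): gh|move/(congr1 (@^~ u)): hg].
Qed.

(** Such a g permutes the roots of the orbit polynomial of u, whose coefficients
    it fixes. *)
Lemma gal_root_transport (g : {rmorphism subfield_of M -> subfield_of M}) u :
  (forall v, @Gal_ext F M v -> g v = v) ->
  exists2 a, a \in labels & subfield_val (g u) = labelled a (subfield_val u).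
Proof.
move=> gF; set x := subfield_val u; have Mx : x \in M by exact: valP.
(* The orbit polynomial, viewed over M, where g acts; the default 0 of insubd is
   never reached as the orbit lies in M. *)
pose P : {poly subfield_of M} :=
  \prod_(r <- [seq insubd 0 r | r <- orbit_seq x]) ('X - r%:P).
have valPE : map_poly \val P = orbit_poly x.
  rewrite -(prod_map_poly _ _ xpredT) -map_comp map_id_in //.
  move=> r /orbit_seqP[a [s [Ras ->]]].
  by rewrite /= insubdK //; exact: label_stable Ras Mx.
have gP : map_poly g P = P.
  apply/polyP => i; rewrite coef_map; apply: gF.
  have := polyOverP (orbit_poly_over _ Mx) i.
  by rewrite -valPE coef_map.
have : root P (g u).
  rewrite -gP; rewrite rmorph_root //.
  rewrite -(fmorph_root (\val : subfield_of M -> algC)) valPE.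
  exact: (orbit_poly_root _ _ _ R1 Mx).
rewrite -(fmorph_root (\val : subfield_of M -> algC)) valPE root_prod_XsubC mem_undup.
by move=> /mapP[a]; rewrite mem_enum => Aa e; exists a.
Qed.

Lemma gal_restricts g : Defs.Gal (@Gal_ext F M) g -> exists a, restricts a g.
Proof.
move=> [[gD gM _]] gF; have [h eh] := rmorphism_of _ _ _ gD gM.
pose v : {rmorphism subfield_of M -> algC} := \val.
subst g; have [u|a Aa ha] := @pointwise_among_finite
  _ _ _ labels (v \o h) (fun a => labelled a \o v).
  exact: gal_root_transport.
by exists a, (labelled a); [exact: labelledP|].
Qed.

(** This group can be nontrivial even when M is all of Qbar: for the relation
    [realizes] below, the automorphisms of X over P^1 label the identity of Qbar by
    inner automorphisms of G. *)
Definition kernel_labels : {set gT} := [set a | `[< restricts a id >]].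

Lemma kernel_labelsP a : reflect (restricts a id) (a \in kernel_labels).
Proof. by rewrite inE; apply: asboolP. Qed.

Lemma kernel_group_set : group_set kernel_labels.
Proof.
apply/group_setP; split=> [|a b /kernel_labelsP Ra /kernel_labelsP Rb].
  by apply/kernel_labelsP; exact: restricts_id.
by apply/kernel_labelsP; exact: restrictsM Ra Rb.
Qed.
Canonical kernel_group := Group kernel_group_set.

Lemma kernel_normal : (kernel_labels <| labels)%g.
Proof.
apply/normalP; split.
  by apply/fintype.subsetP => a /kernel_labelsP; exact: restricts_label.
have sub a : a \in labels -> (kernel_labels :^ a \subset kernel_labels)%g.
  move=> Aa; apply/fintype.subsetP => _ /imsetP[b /kernel_labelsP bi ->].
  have /restricts_exists[g ag] := Aa.
  have /restricts_exists[h ah] : a^-1%g \in labels by rewrite groupV.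
  apply/kernel_labelsP; rewrite conjgE.
  have hg : id = h \o g.
    by apply: (restricts_inj restricts_id); rewrite -(mulVg a); exact: restrictsM.
  by rewrite hg; exact: restrictsM ah (restrictsM bi ag).
by move=> a Aa; apply/eqP; rewrite eqEcard sub //= cardJg.
Qed.

Lemma labels_norm {a} : a \in labels -> a \in 'N(kernel_labels)%g.
Proof. by move/(fintype.subsetP (normal_norm kernel_normal)). Qed.

(** All labels of g lie in one coset of the kernel, so the choice made here is
    immaterial. *)
Definition gal_label (g : subfield_of M -> subfield_of M) : coset_of kernel_labels :=
  coset kernel_labels (xget 1%g [set a | restricts a g]).

Lemma gal_labelE a g : restricts a g -> gal_label g = coset kernel_labels a.
Proof.
move=> ag; rewrite /gal_label.
have /= bg := @xgetPex _ 1%g [set a | restricts a g] (ex_intro _ a ag).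
set b := xget _ _ in bg *.
have [Aa Ab] := (restricts_label ag, restricts_label bg).
apply/rcoset_kercosetP; [exact: labels_norm|exact: labels_norm|].
rewrite mem_rcoset; apply/kernel_labelsP.
have /restricts_exists[h ah] : a^-1%g \in labels by rewrite groupV.
have -> : id = g \o h.
  by apply: (restricts_inj restricts_id); rewrite -(mulgV a); exact: restrictsM.
exact: restrictsM bg ah.
Qed.

Lemma gal_label_isom : Gal_isom (@Gal_ext F M) (labels / kernel_labels)%g gal_label.
Proof.
split.
- split.
  + move=> g /gal_restricts[a ag] /=; rewrite (gal_labelE _ _ ag).
    by apply: mem_quotient; exact: restricts_label ag.
  + move=> g h /set_mem /gal_restricts[a ag] /set_mem /gal_restricts[b bh].
    rewrite (gal_labelE _ _ ag) (gal_labelE _ _ bh).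
    have [Aa Ab] := (restricts_label ag, restricts_label bh).
    move/rcoset_kercosetP => /(_ (labels_norm Aa) (labels_norm Ab)).
    move=> /rcosetP[k /kernel_labelsP ki ea].
    by apply: (restricts_inj ag); rewrite ea; exact: restrictsM ki bh.
  + move=> _ /= /morphimP[a _ Aa ->].
    have /restricts_exists[g ag] := Aa.
    by exists g; [exact: restricts_gal ag|exact: gal_labelE].
- move=> g h /gal_restricts[a ag] /gal_restricts[b bh].
  rewrite (gal_labelE _ _ ag) (gal_labelE _ _ bh) (gal_labelE _ _ (restrictsM ag bh)).
  by rewrite morphM ?labels_norm ?(restricts_label ag) ?(restricts_label bh).
Qed.

End ArtinRelation.

(** * The action of Aut(Qbar) on Qbar(t) *)

Lemma frac_map_id f : frac_map idfun f = f.
Proof.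
rewrite {1}(frac_numden f) frac_mapE; last exact: denom_ratioP.
by rewrite !map_poly_id // -frac_numden.
Qed.

Lemma frac_map_comp (s t : {rmorphism algC -> algC}) f :
  frac_map (s \o t) f = frac_map s (frac_map t f).
Proof.
rewrite (frac_numden f); have := denom_ratioP (generic_quotient.repr f).
move: (frac _) => [n d] /= d0.
rewrite (frac_mapE _ _ d0) (frac_mapE t _ d0) (frac_mapE s) ?map_poly_eq0 //.
have stE p : map_poly (s \o t) p = map_poly s (map_poly t p) by exact: map_poly_comp.
by rewrite !stE.
Qed.

Lemma eq_frac_map (s t : {rmorphism algC -> algC}) :
  s =1 t -> frac_map s =1 frac_map t.
Proof. by move=> st f; rewrite /frac_map !(eq_map_poly st). Qed.

Lemma frac_mapK (s : {rmorphism algC -> algC}) :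
  cancel (frac_map s) (frac_map (algC_invaut s)).
Proof.
move=> f; rewrite -frac_map_comp -[RHS]frac_map_id.
by apply: eq_frac_map => x /=; rewrite algC_autK.
Qed.

Lemma frac_mapVK (s : {rmorphism algC -> algC}) :
  cancel (frac_map (algC_invaut s)) (frac_map s).
Proof.
move=> f; rewrite -frac_map_comp -[RHS]frac_map_id.
by apply: eq_frac_map => x /=; rewrite algC_invautK.
Qed.

(** * Semilinear automorphisms of the cover *)

Section RingAut.
Variable L : fieldType.

Lemma ring_aut_id : ring_aut (id : L -> L).
Proof. by split=> //; exists id. Qed.

Lemma ring_aut_comp {f g : L -> L} : ring_aut f -> ring_aut g -> ring_aut (f \o g).
Proof.
move=> [fD [f1 fM] fB] [gD [g1 gM] gB]; split; last exact: bij_comp.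
  by move=> x y /=; rewrite gD fD.
by split=> [|x y] /=; rewrite ?g1 // gM fM.
Qed.

Lemma ring_autV {f g : L -> L} : ring_aut f -> cancel f g -> cancel g f -> ring_aut g.
Proof.
move=> [fD [f1 fM] fB] fK gK; have fI := can_inj fK; split; last by exists f.
  by move=> x y; apply: fI; rewrite fD !gK.
by split=> [|x y]; apply: fI; rewrite ?f1 ?fM !gK.
Qed.

End RingAut.

Section SemilinearMaps.
Variable X : P1scheme.

(** As twisting changes only the structure morphism, an isomorphism between X and
    its twist by s is a self-map of kappa(X) that is s-linear rather than linear
    over Qbar(t); these maps compose and invert without mention of twists. *)
Definition semilinear_aut (s : {rmorphism algC -> algC})
    (phi : ffield X -> ffield X) : Prop :=
  [/\ ring_aut phi, forall f, phi (pullback X f) = pullback X (frac_map s f)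
    & forall b x, (phi x \in sect X b) = (x \in sect X b)].

Lemma cover_isom_twist s phi :
  @cover_isom (twist s X) X phi <-> semilinear_aut s phi.
Proof.
split=> [[aut [lin int]]|[aut lin int]]; split=> //.
- by move=> f; rewrite -[in LHS](frac_mapK s f); exact: lin.
- by split=> // f; rewrite /= lin frac_mapVK.
Qed.

Lemma Gal_cover_twist s : Gal_cover (X := twist s X) = Gal_cover (X := X).
Proof.
suff e : range (pullback (twist s X)) = range (pullback X) by rewrite /Gal_cover e.
apply/seteqP; split=> _ [f _ <-]; first by exists (frac_map (algC_invaut s) f).
by exists (frac_map s f) => //=; rewrite frac_mapK.
Qed.

Lemma semilinear_id : semilinear_aut idfun id.
Proof. by split=> // [|f]; [exact: ring_aut_id|rewrite frac_map_id]. Qed.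

Lemma semilinear_comp {s t phi psi} :
  semilinear_aut s phi -> semilinear_aut t psi -> semilinear_aut (s \o t) (phi \o psi).
Proof.
move=> [pA pl pi] [qA ql qi]; split; first exact: ring_aut_comp.
  by move=> f; rewrite /= ql pl frac_map_comp.
by move=> b x; rewrite /= pi qi.
Qed.

Lemma semilinearV {s phi psi} :
  semilinear_aut s phi -> cancel phi psi -> cancel psi phi ->
  semilinear_aut (algC_invaut s) psi.
Proof.
move=> [pA pl pi] pK qK; split; first exact: ring_autV pA pK qK.
  by move=> f; apply: (can_inj pK); rewrite qK pl frac_mapVK.
by move=> b x; rewrite -pi qK.
Qed.

Lemma semilinear_bij {s phi} : semilinear_aut s phi ->
  exists psi, [/\ cancel phi psi, cancel psi phi & semilinear_aut (algC_invaut s) psi].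
Proof.
move=> hphi; have [[_ _ [psi pK qK]] _ _] := hphi.
by exists psi; split=> //; exact: semilinearV hphi pK qK.
Qed.

Lemma Gal_cover_comp {g h : ffield X -> ffield X} :
  Gal_cover g -> Gal_cover h -> Gal_cover (g \o h).
Proof.
move=> [gA gfix] [hA hfix]; split; first exact: ring_aut_comp.
by move=> z Ez; rewrite /= hfix // gfix.
Qed.

(** phi maps the image of Qbar(t) onto itself, so conjugation by it preserves the
    automorphisms fixing this subfield. *)
Lemma Gal_cover_conj {s phi psi g} :
  semilinear_aut s phi -> cancel phi psi -> cancel psi phi ->
  Gal_cover g -> Gal_cover (psi \o g \o phi).
Proof.
move=> hphi pK qK [gA gfix].
have [qA _ _] := semilinearV hphi pK qK; have [pA pl _] := hphi.
split; first by apply: ring_aut_comp => //; exact: ring_aut_comp.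
by move=> _ [f _ <-]; rewrite /= pl gfix; [rewrite -pl pK|exists (frac_map s f)].
Qed.

End SemilinearMaps.

(** * Automorphisms of G induced by twists *)

Section InducedAutomorphisms.
Variables (K : fieldExtType rat) (iota : {rmorphism K -> algC}).
Variables (G : finGroupType) (X : P1scheme) (Phi : (ffield X -> ffield X) -> G).
Hypothesis PhiG : Gal_isom (range (pullback X)) [set: G]%SET Phi.

Lemma Phi_inj g h : Gal_cover g -> Gal_cover h -> Phi g = Phi h -> g = h.
Proof. by case: PhiG => [[_ inj _] _] gG hG; apply: inj; exact: mem_set. Qed.

Lemma PhiM {g h} : Gal_cover g -> Gal_cover h -> Phi (g \o h) = (Phi g * Phi h)%g.
Proof. by case: PhiG => _ hM; exact: hM. Qed.

Lemma Phi_surj a : exists2 g, Gal_cover g & Phi g = a.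
Proof.
case: PhiG => [[_ _ surj] _].
by have [|g gG <-] := surj a; [rewrite /= inE|exists g].
Qed.

(** The condition says that a is, through Phi, the conjugation g |-> phi^-1 g phi.
    This direction, and not phi g phi^-1, makes the relation multiplicative:
    composition of maps is contravariant with respect to the product of
    permutations. *)
Definition realizes (a : {perm G}) (s : {rmorphism algC -> algC}) : Prop :=
  [/\ absolute_Gal iota s, a \in Aut [set: G]
    & exists2 phi, semilinear_aut X s phi &
      forall g h, Gal_cover g -> Gal_cover h ->
        phi \o g =1 h \o phi -> Phi g = a (Phi h)].

Lemma realizes1 : realizes 1%g idfun.
Proof.
split=> //; exists id; first exact: semilinear_id.
by move=> g h _ _ gh; rewrite perm1; congr Phi; apply/funext => x; exact: gh.
Qed.

Lemma realizesM a b (s t : {rmorphism algC -> algC}) :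
  realizes a s -> realizes b t -> realizes (a * b)%g (s \o t).
Proof.
move=> [sK aA [phi hphi pa]] [tK bA [psi hpsi pb]]; split.
- by move=> x /=; rewrite tK sK.
- exact: groupM.
exists (phi \o psi); first exact: semilinear_comp.
move=> g h gG hG gh; have [psi' [pK qK hpsi']] := semilinear_bij _ hpsi.
(* k = psi g psi^-1 lies between g and h. *)
have kG := Gal_cover_conj _ hpsi' qK pK gG.
rewrite permM (pb g _ gG kG); last by move=> x /=; rewrite pK.
by rewrite (pa _ h kG hG) // => x /=; have /= -> := gh (psi' x); rewrite qK.
Qed.

Lemma realizesV a s : realizes a s -> realizes a^-1%g (algC_invaut s).
Proof.
move=> [sK aA [phi hphi pa]]; have [psi [pK qK hpsi]] := semilinear_bij _ hphi.
split; [by move=> x; rewrite -[in LHS](sK x); exact: algC_autK|by rewrite groupV|].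
exists psi => // g h gG hG gh; apply: (@perm_inj _ a); rewrite permKV.
rewrite -(pa h g hG gG) // => x; apply: (can_inj qK) => /=.
by have /= -> := gh (phi x); rewrite !pK.
Qed.

(** The automorphism a is x |-> Phi (phi^-1 (Phi^-1 x) phi). *)
Lemma semilinear_realizes s phi :
  absolute_Gal iota s -> semilinear_aut X s phi -> exists a, realizes a s.
Proof.
move=> sK hphi; have [psi [pK qK hpsi]] := semilinear_bij _ hphi.
pose gal x := projT1 (cid2 (Phi_surj x)).
have galG x : Gal_cover (gal x) by rewrite /gal; case: cid2.
have galK x : Phi (gal x) = x by rewrite /gal; case: cid2.
have galM x y : gal (x * y)%g = gal x \o gal y.
  apply: (Phi_inj _ _ (galG _) (Gal_cover_comp _ (galG x) (galG y))).
  by rewrite galK (PhiM (galG x) (galG y)) !galK.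
pose a0 x := Phi (psi \o gal x \o phi).
have conjG x : Gal_cover (psi \o gal x \o phi).
  by exact: Gal_cover_conj hphi pK qK (galG x).
have a0I : injective a0.
  move=> x y /(Phi_inj _ _ (conjG x) (conjG y)) e.
  rewrite -(galK x) -(galK y); congr Phi; apply/funext => z.
  by apply: (can_inj qK); have /(congr1 (@^~ (psi z))) /= := e; rewrite !qK.
exists (perm a0I); split=> //.
  rewrite inE; apply/andP; split; first by apply/fintype.subsetP => x; rewrite inE.
  apply/morphicP => x y _ _; rewrite !permE /a0 -(PhiM (conjG x) (conjG y)) galM.
  by congr Phi; apply/funext => z /=; rewrite qK.
exists phi => // g h gG hG gh; rewrite permE /a0.
have -> : gal (Phi h) = h by apply: Phi_inj; rewrite ?galK.
by congr Phi; apply/funext => z /=; rewrite -[RHS]/(psi ((h \o phi) z)) -gh /= pK.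
Qed.

Lemma realized_mereP s :
  (absolute_Gal iota s /\ mere_isomorphic (twist s X) X) <-> exists a, realizes a s.
Proof.
split=> [[sK [phi /cover_isom_twist hphi]]|[a [sK _ [phi hphi _]]]].
  exact: semilinear_realizes hphi.
by split=> //; exists phi; apply/cover_isom_twist.
Qed.

Lemma realized_GP s :
  (absolute_Gal iota s /\ G_isomorphic (twist_Gal (s := s) Phi) Phi) <-> realizes 1%g s.
Proof.
rewrite /G_isomorphic Gal_cover_twist; split.
  move=> [sK [phi /cover_isom_twist hphi pg]]; split; rewrite ?group1 //.
  by exists phi => // g h gG hG gh; rewrite perm1; exact: pg.
move=> [sK _ [phi hphi pg]]; split=> //; exists phi; first exact/cover_isom_twist.
by move=> g h gG hG gh; rewrite [LHS](pg g h) // perm1.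
Qed.

End InducedAutomorphisms.

(** * Fields of moduli *)

Theorem corollary3p8 (K : fieldExtType rat) (iota : {rmorphism K -> algC})
    (G : finGroupType) (X : P1scheme) (Phi : (ffield X -> ffield X) -> G)
    (hX : G_galois_cover Phi) :
  let F := mere_field_of_moduli iota X in
  let M := G_field_of_moduli iota Phi in
  galois_extension F M /\ Gal_subquotient_of_Aut F M G.
Proof.
have [_ PhiG] := hX; pose R := realizes _ iota _ _ Phi.
have R1 : R 1%g idfun by exact: realizes1.
have RM a b (s t : {rmorphism algC -> algC}) : R a s -> R b t -> R (a * b)%g (s \o t).
  exact: realizesM.
have RV a s : R a s -> R a^-1%g (algC_invaut s) by exact: realizesV.
have eF : mere_field_of_moduli iota X = fixed_field [set s | exists a, R a s].
  by congr fixed_field; apply/seteqP; split=> s /realized_mereP; exact.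
have eM : G_field_of_moduli iota Phi = fixed_field [set s | R 1%g s].
  by congr fixed_field; apply/seteqP; split=> s /realized_GP.
rewrite eF eM; split; first exact: fixed_field_galois R1 RM RV.
exists (labels_group _ _ R1 RM), (kernel_group _ _ R1 RM); split.
- by apply/fintype.subsetP => a /labelsP[s []].
- exact: kernel_normal.
- by eexists; exact: gal_label_isom.
Qed.
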